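(* Let $\mathcal{C}$ be an abelian category and let $\mathcal{X},\mathcal{Y}\subseteq\mathcal{C}$ be classes of objects such that $\mathcal{Y}=\mathcal{Y}^{\oplus_{<\infty}}$, $\mathcal{X}=\mathrm{smd}(\mathcal{X})$ is closed under extensions and $\mathrm{Ext}^1_{\mathcal{C}}(\mathcal{X},\mathcal{X}\cap\mathcal{Y})=0$ (i.e. $\mathrm{Ext}^1_{\mathcal{C}}(X,Y)=0$ for all $X\in\mathcal{X}$, $Y\in\mathcal{X}\cap\mathcal{Y}$). Then the following statements hold true. (a) $(\mathcal{X},\mathcal{Y})_{\infty}^{\vee}=(\mathcal{X},\mathcal{X}\cap\mathcal{Y})_{\infty}^{\vee}$ and it is closed under extensions and direct summands. Moreover, $(\mathcal{X},\mathcal{Y})^{\vee}=(\mathcal{X},\mathcal{X}\cap\mathcal{Y})^{\vee}$ and it is closed under extensions. (b) $(\mathcal{X},\mathcal{Y})_{\infty}^{\vee}$ is left thick if $\mathcal{X}$ is left thick.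
   Context: $\mathrm{smd}(\mathcal{M})$ is the class of all direct summands of objects in $\mathcal{M}$; $\mathcal{M}^{\oplus_{<\infty}}$ is the class of all finite coproducts of objects in $\mathcal{M}$. $\mathrm{Ext}$ is Yoneda Ext. A class is left thick if it is closed under extensions, direct summands and epi-kernels, where $\mathcal{M}$ is closed under epi-kernels if for every exact sequence $0\to M''\to M'\to M\to0$ with $M',M\in\mathcal{M}$ one has $M''\in\mathcal{M}$. For classes $\mathcal{P},\mathcal{Q}\subseteq\mathcal{C}$ and $M\in\mathcal{C}$: a $\mathcal{Q}_{\mathcal{P}}$-coresolution of $M$ is an exact sequence $0\to M\xrightarrow{f_0}Q_0\xrightarrow{f_1}Q_1\to\cdots\to Q_{n-1}\xrightarrow{f_n}Q_n\to\cdots$ with $Q_k\in\mathcal{Q}\cup\{0\}$ for all $k\ge0$ and $\mathrm{Im}(f_i)\in\mathcal{P}\cup\{0\}$ for all $i\ge1$. A $\mathcal{Q}_{\mathcal{P}}$-coresolution of length $n$ of $M$ is an exact sequence $0\to M\xrightarrow{f_0}Q_0\xrightarrow{f_1}Q_1\to\cdots\xrightarrow{f_n}Q_n\to0$ with $Q_n\in\mathcal{P}\cap\mathcal{Q}$, $Q_k\in\mathcal{Q}$ for $0\le k\le n-1$, and $\mathrm{Im}(f_i)\in\mathcal{P}$ for $1\le i\le n-1$. $\mathcal{Q}_{\mathcal{P},\infty}^{\vee}$ (resp. $\mathcal{Q}_{\mathcal{P}}^{\vee}$) is the class of all objects having a $\mathcal{Q}_{\mathcal{P}}$-coresolution (resp.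 a $\mathcal{Q}_{\mathcal{P}}$-coresolution of some finite length $n\ge0$). Finally, $(\mathcal{P},\mathcal{Q})_{\infty}^{\vee}:=\mathcal{P}\cap\mathcal{Q}_{\mathcal{P},\infty}^{\vee}$ and $(\mathcal{P},\mathcal{Q})^{\vee}:=\mathcal{P}\cap\mathcal{Q}_{\mathcal{P}}^{\vee}$. *)

(* Defs.v *)
From mathcomp Require Import all_boot all_algebra.
From mathcomp Require Import boolp classical_sets.

Set Implicit Arguments.
Unset Strict Implicit.
Unset Printing Implicit Defensive.

Import GRing.Theory.
Local Open Scope ring_scope.
Local Open Scope classical_set_scope.

Reserved Notation "g \oc f" (at level 40, left associativity).

(** * Abelian categories *)

(* Preadditive categories. A zmodType carries a choice operator; classically
   every abelian group has one, so this does not restrict the hom-groups. *)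
Record preadditiveCategory := PreadditiveCategory {
  obj :> Type;
  hom : obj -> obj -> zmodType;
  idm : forall A, hom A A;
  comp : forall A B D, hom B D -> hom A B -> hom A D;
  comp1m : forall A B (f : hom A B), comp (idm B) f = f;
  compm1 : forall A B (f : hom A B), comp f (idm A) = f;
  compA : forall A B D E (h : hom D E) (g : hom B D) (f : hom A B),
    comp h (comp g f) = comp (comp h g) f;
  compDl : forall A B D (g g' : hom B D) (f : hom A B),
    comp (g + g') f = comp g f + comp g' f;
  compDr : forall A B D (g : hom B D) (f f' : hom A B),
    comp g (f + f') = comp g f + comp g f'
}.

Arguments hom {p} A B.
Arguments idm {p} A.
Arguments comp {p A B D} g f.

Notation "g \oc f" := (comp g f).

Section Preadditive.

Variable C : preadditiveCategory.
Implicit Types A B D E K S T : C.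

Definition monic A B (f : hom A B) : Prop :=
  forall T (u v : hom T A), f \oc u = f \oc v -> u = v.

Definition epic A B (f : hom A B) : Prop :=
  forall T (u v : hom B T), u \oc f = v \oc f -> u = v.

Definition is_zero_object A : Prop :=
  (forall T (f : hom A T), f = 0) /\ (forall T (f : hom T A), f = 0).

Definition zero_objects : set C := [set A | is_zero_object A].

Definition is_kernel A B K (f : hom A B) (k : hom K A) : Prop :=
  f \oc k = 0 /\
  forall T (t : hom T A), f \oc t = 0 -> exists! u : hom T K, k \oc u = t.

Definition is_cokernel A B K (f : hom A B) (c : hom B K) : Prop :=
  c \oc f = 0 /\
  forall T (t : hom B T), t \oc f = 0 -> exists! u : hom K T, u \oc c = t.

(* S, with injections iA, iB and projections pA, pB, is A (+) B. *)
Definition is_biproduct A B S (iA : hom A S) (iB : hom B S)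
    (pA : hom S A) (pB : hom S B) : Prop :=
  [/\ pA \oc iA = idm A, pB \oc iB = idm B, pA \oc iB = 0, pB \oc iA = 0
    & iA \oc pA + iB \oc pB = idm S].

Definition is_coproduct (I : Type) (F : I -> C) S
    (inj : forall i, hom (F i) S) : Prop :=
  forall T (g : forall i, hom (F i) T),
    exists! h : hom S T, forall i, h \oc inj i = g i.

(* The image of f, as the subobject Ker (Coker f) of the target. *)
Definition is_image A B K (f : hom A B) (m : hom K B) : Prop :=
  exists (D : C) (c : hom B D), is_cokernel f c /\ is_kernel c m.

(* Exactness of A -> B -> D at B: Im f = Ker g as subobjects of B. *)
Definition exact A B D (f : hom A B) (g : hom B D) : Prop :=
  exists (K : C) (m : hom K B), is_image f m /\ is_kernel g m.

Definition short_exact A B D (f : hom A B) (g : hom B D) : Prop :=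
  [/\ monic f, exact f g & epic g].

End Preadditive.

Record abelianCategory := AbelianCategory {
  abelian_preadditive :> preadditiveCategory;
  ab_zero : exists Z : abelian_preadditive, is_zero_object Z;
  ab_biproduct : forall A B : abelian_preadditive,
    exists (S : abelian_preadditive) (iA : hom A S) (iB : hom B S)
      (pA : hom S A) (pB : hom S B), is_biproduct iA iB pA pB;
  ab_kernel : forall (A B : abelian_preadditive) (f : hom A B),
    exists (K : abelian_preadditive) (k : hom K A), is_kernel f k;
  ab_cokernel : forall (A B : abelian_preadditive) (f : hom A B),
    exists (K : abelian_preadditive) (c : hom B K), is_cokernel f c;
  ab_monic_normal : forall (A B : abelian_preadditive) (f : hom A B),
    monic f ->
    exists (D : abelian_preadditive) (g : hom B D), is_kernel g f;
  ab_epic_normal : forall (A B : abelian_preadditive) (f : hom A B),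
    epic f ->
    exists (D : abelian_preadditive) (g : hom D A), is_cokernel g f
}.

Section Abelian.

Variable C : abelianCategory.
Implicit Types A B M N : C.
Implicit Types P Q X Y : set C.

(** * The first Yoneda Ext *)

(* Representatives of the elements of Ext^1(A, B): 0 -> B -> E -> A -> 0. *)
Record extension A B := Extension {
  ext_mid : C;
  ext_in : hom B ext_mid;
  ext_out : hom ext_mid A;
  ext_exact : short_exact ext_in ext_out
}.

(* Yoneda equivalence. In degree 1 a single morphism of extensions suffices,
   being invertible by the five lemma. *)
Definition yoneda_equiv A B (e e' : extension A B) : Prop :=
  exists h : hom (ext_mid e) (ext_mid e'),
    h \oc ext_in e = ext_in e' /\ ext_out e' \oc h = ext_out e.

(* The extension 0 -> B -> B (+) A -> A -> 0, representing 0 in Ext^1(A, B). *)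
Definition is_trivial_extension A B (e : extension A B) : Prop :=
  exists (iA : hom A (ext_mid e)) (pB : hom (ext_mid e) B),
    is_biproduct (ext_in e) iA pB (ext_out e).

Definition Ext1_eq0 A B : Prop :=
  forall e : extension A B,
    exists e0 : extension A B, is_trivial_extension e0 /\ yoneda_equiv e e0.

Definition Ext1_class_eq0 P Q : Prop :=
  forall A B, P A -> Q B -> Ext1_eq0 A B.

(** * Closure properties *)

Definition smd P : set C :=
  [set A | exists (B S : C) (iA : hom A S) (iB : hom B S)
             (pA : hom S A) (pB : hom S B),
           is_biproduct iA iB pA pB /\ P S].

(* The case n = 0 is the empty coproduct, i.e. the zero objects. *)
Definition fin_coproducts P : set C :=
  [set S | exists (n : nat) (F : 'I_n -> C) (inj : forall i, hom (F i) S),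
           is_coproduct inj /\ forall i, P (F i)].

Definition extension_closed P : Prop :=
  forall A B D (f : hom A B) (g : hom B D),
    short_exact f g -> P A -> P D -> P B.

Definition summand_closed P : Prop := smd P `<=` P.

Definition epikernel_closed P : Prop :=
  forall A B D (f : hom A B) (g : hom B D),
    short_exact f g -> P B -> P D -> P A.

Definition left_thick P : Prop :=
  [/\ extension_closed P, summand_closed P & epikernel_closed P].

(** * Coresolutions *)

Definition image_in P A B (f : hom A B) : Prop :=
  exists (K : C) (m : hom K B), is_image f m /\ P K.

(* Exact sequences 0 -> M -> Q_0 -> Q_1 -> ..., where Q_k = cr_obj k,
   f_0 = cr_aug and f_k.+1 = cr_map k. *)
Record exact_coseq M := ExactCoseq {
  cr_obj : nat -> C;
  cr_aug : hom M (cr_obj 0%N);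
  cr_map : forall k, hom (cr_obj k) (cr_obj k.+1);
  cr_monic : monic cr_aug;
  cr_exact0 : exact cr_aug (cr_map 0%N);
  cr_exactS : forall k, exact (cr_map k) (cr_map k.+1)
}.

Definition is_coresolution P Q M (s : exact_coseq M) : Prop :=
  (forall k, (Q `|` @zero_objects C) (cr_obj s k)) /\
  (forall k, image_in (P `|` @zero_objects C) (cr_map s k)).

(* The sequence 0 -> M -> Q_0 -> ... -> Q_n -> 0 is encoded by extending it
   with zero objects beyond Q_n, exactness at Q_n being then part of s. The
   condition on images is Im(f_i) \in P for 1 <= i <= n - 1. *)
Definition is_coresolution_of_length P Q M (n : nat) (s : exact_coseq M) :
    Prop :=
  [/\ forall k, (n < k)%N -> is_zero_object (cr_obj s k),
      (P `&` Q) (cr_obj s n),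
      forall k, (k < n)%N -> Q (cr_obj s k)
    & forall k, (k.+1 < n)%N -> image_in P (cr_map s k)].

Definition cores_inf P Q : set C :=
  [set M | exists s : exact_coseq M, is_coresolution P Q s].

Definition cores_fin P Q : set C :=
  [set M | exists (n : nat) (s : exact_coseq M),
           is_coresolution_of_length P Q n s].

(* (P, Q)_oo^v and (P, Q)^v *)
Definition rel_cores_inf P Q : set C := P `&` cores_inf P Q.

Definition rel_cores_fin P Q : set C := P `&` cores_fin P Q.

End Abelian.

(* Main.v *)
Require Import Defs.
From mathcomp Require Import all_boot all_algebra.
From mathcomp Require Import boolp classical_sets.

Local Open Scope classical_set_scope.

(** Call F(V) the class of all M in X admitting a short exact sequence
0 -> M -> Q_0 -> K -> 0 with Q_0 in Y and K in V. Splitting coresolutions at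
their images shows that (X, Y)_oo^v is the largest class V contained in F(V),
while (X, Y)^v is the union of the iterates of F on the zero objects of X. Since
X is closed under extensions, Q_0 lies in X as soon as M and K do, so that Y may
be replaced by the intersection of X and Y. The vanishing of Ext^1 gives a
horseshoe lemma, by which an extension of objects of F(V) lies in F(the class of
extensions of objects of V); closure under extensions follows by coinduction,
resp. induction. For a summand M of S = M (+) N with 0 -> S -> Q_0 -> S' -> 0, the
cokernel L of M -> Q_0 is an extension of S' by N, so L (+) M is an extension of
S' by S and L is again a summand of an object of (X, Y)_oo^v. For an epi-kernel
0 -> A -> B -> D -> 0 with 0 -> B -> Q_0 -> B' -> 0, the cokernel of A -> Q_0 is
an extension of B' by D. *)

Set Implicit Arguments.
Unset Strict Implicit.
Unset Printing Implicit Defensive.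

Import GRing.Theory.
(* Reclaims [hom] from mathcomp's vector library. *)
Import Defs.
Local Open Scope ring_scope.

(** * Kernels, cokernels and biproducts in preadditive categories *)

Section Preadditive.

Variable C : preadditiveCategory.
Implicit Types A B D E K S T : C.

Lemma comp0m A B D (f : hom A B) : (0 : hom B D) \oc f = 0.
Proof. by apply: (addrI ((0 : hom B D) \oc f)); rewrite -compDl !addr0. Qed.

Lemma compm0 A B D (g : hom B D) : g \oc (0 : hom A B) = 0.
Proof. by apply: (addrI (g \oc (0 : hom A B))); rewrite -compDr !addr0. Qed.

Lemma compNm A B D (g : hom B D) (f : hom A B) : (- g) \oc f = - (g \oc f).
Proof. by apply: (addrI (g \oc f)); rewrite -compDl !subrr comp0m. Qed.

Lemma compmN A B D (g : hom B D) (f : hom A B) : g \oc (- f) = - (g \oc f).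
Proof. by apply: (addrI (g \oc f)); rewrite -compDr !subrr compm0. Qed.

Lemma monic0P A B (f : hom A B) :
  monic f <-> (forall T (t : hom T A), f \oc t = 0 -> t = 0).
Proof.
split=> [mf T t ft0|f0 T u v fuv]; first by apply: mf; rewrite ft0 compm0.
by apply/eqP; rewrite -subr_eq0; apply/eqP/f0; rewrite compDr compmN fuv subrr.
Qed.

Lemma epic0P A B (f : hom A B) :
  epic f <-> (forall T (t : hom B T), t \oc f = 0 -> t = 0).
Proof.
split=> [ef T t tf0|f0 T u v uvf]; first by apply: ef; rewrite tf0 comp0m.
by apply/eqP; rewrite -subr_eq0; apply/eqP/f0; rewrite compDl compNm uvf subrr.
Qed.

Lemma monic_idm A : monic (idm A).
Proof. by move=> T u v; rewrite !comp1m. Qed.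

Lemma epic_idm A : epic (idm A).
Proof. by move=> T u v; rewrite !compm1. Qed.

Lemma monic_comp A B D (g : hom B D) (f : hom A B) :
  monic g -> monic f -> monic (g \oc f).
Proof. by move=> mg mf T u v; rewrite -!compA => /mg /mf. Qed.

Lemma epic_comp A B D (g : hom B D) (f : hom A B) :
  epic g -> epic f -> epic (g \oc f).
Proof. by move=> eg ef T u v; rewrite !compA => /ef /eg. Qed.

Lemma epic_of_comp A B D (g : hom B D) (f : hom A B) :
  epic (g \oc f) -> epic g.
Proof. by move=> e T u v uv; apply: e; rewrite !compA uv. Qed.

Lemma split_monic A B (r : hom B A) (f : hom A B) : r \oc f = idm A -> monic f.
Proof. by move=> rf T u v fuv; rewrite -[u]comp1m -rf -compA fuv compA rf comp1m. Qed.

Lemma split_epic A B (f : hom A B) (s : hom B A) : f \oc s = idm B -> epic f.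
Proof. by move=> fs T u v uvf; rewrite -[u]compm1 -fs compA uvf -compA fs compm1. Qed.

Lemma kernel_monic A B K (f : hom A B) (k : hom K A) : is_kernel f k -> monic k.
Proof.
move=> [fk0 kP] T u v kuv; have [|w [_ wU]] := kP T (k \oc u).
  by rewrite compA fk0 comp0m.
by rewrite -(wU u erefl) -(wU v (esym kuv)).
Qed.

Lemma cokernel_epic A B K (f : hom A B) (c : hom B K) :
  is_cokernel f c -> epic c.
Proof.
move=> [cf0 cP] T u v uvc; have [|w [_ wU]] := cP T (u \oc c).
  by rewrite -compA cf0 compm0.
by rewrite -(wU u erefl) -(wU v (esym uvc)).
Qed.

Lemma kernelP A B K (f : hom A B) (k : hom K A) :
  is_kernel f k <->
  [/\ monic k, f \oc k = 0 &
      forall T (t : hom T A), f \oc t = 0 -> exists u, k \oc u = t].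
Proof.
split=> [kf|[mk fk0 kP]].
  split; [exact: kernel_monic kf|exact: kf.1|] => T t /kf.2 [u [ku _]].
  by exists u.
split=> // T t /kP [u ku]; exists u; split=> // v kv.
by apply: mk; rewrite ku kv.
Qed.

Lemma cokernelP A B K (f : hom A B) (c : hom B K) :
  is_cokernel f c <->
  [/\ epic c, c \oc f = 0 &
      forall T (t : hom B T), t \oc f = 0 -> exists u, u \oc c = t].
Proof.
split=> [cf|[ec cf0 cP]].
  split; [exact: cokernel_epic cf|exact: cf.1|] => T t /cf.2 [u [uc _]].
  by exists u.
split=> // T t /cP [u uc]; exists u; split=> // v vc.
by apply: ec; rewrite uc vc.
Qed.

Lemma kernel_monic_comp A B D K (m : hom B D) (e : hom A B) (k : hom K A) :
  monic m -> is_kernel (m \oc e) k <-> is_kernel e k.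
Proof.
move=> /monic0P mm; rewrite !kernelP.
split=> -[mk k0 kP]; split=> //.
- by apply: mm; rewrite compA.
- by move=> T t et0; apply: kP; rewrite -compA et0 compm0.
- by rewrite -compA k0 compm0.
- by move=> T t; rewrite -compA => /mm; exact: kP.
Qed.

Lemma cokernel_comp_epic A B D K (m : hom B D) (e : hom A B) (c : hom D K) :
  epic e -> is_cokernel (m \oc e) c <-> is_cokernel m c.
Proof.
move=> /epic0P ee; rewrite !cokernelP.
split=> -[ec c0 cP]; split=> //.
- by apply: ee; rewrite -compA.
- by move=> T t tm0; apply: cP; rewrite compA tm0 comp0m.
- by rewrite compA c0 comp0m.
- by move=> T t; rewrite compA => /ee; exact: cP.
Qed.

Lemma zero_objectP A : is_zero_object A <-> idm A = 0.
Proof.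
split=> [[A0 _]|idA0]; first exact: A0.
split=> T t; first by rewrite -[t]compm1 idA0 compm0.
by rewrite -[t]comp1m idA0 comp0m.
Qed.

Lemma zero_object_monic A B (f : hom A B) :
  monic f -> is_zero_object B -> is_zero_object A.
Proof.
move=> mf [_ B0]; apply/zero_objectP; apply: mf.
by rewrite compm1 (B0 _ f) comp0m.
Qed.

Lemma biproduct_zero A Z :
  is_zero_object Z -> is_biproduct (idm A) (0 : hom Z A) (idm A) 0.
Proof.
by move=> [Z0 _]; split; rewrite ?comp1m ?compm1 ?comp0m ?addr0.
Qed.

Lemma biproduct_sym A B S (iA : hom A S) (iB : hom B S) pA pB :
  is_biproduct iA iB pA pB -> is_biproduct iB iA pB pA.
Proof. by move=> [*]; split=> //; rewrite addrC. Qed.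

End Preadditive.

(** * Normality, images and exactness in abelian categories *)

Section Abelian.

Variable C : abelianCategory.
Implicit Types A B D E K M N S T Z : C.
Implicit Types P Q V X Y : set C.

(** [f] is the kernel of some [d], and [d] factors through the cokernel [g]; so whatever [g] kills,
    [d] kills as well. *)
Lemma monic_kernel_of_cokernel A B D (f : hom A B) (g : hom B D) :
  monic f -> is_cokernel f g -> is_kernel g f.
Proof.
move=> mf /cokernelP [_ gf0 gP]; apply/kernelP; split=> // T t gt0.
have [E [d /kernelP [_ df0 dP]]] := ab_monic_normal mf.
have [d' d'g] := gP _ _ df0.
by apply: dP; rewrite -d'g -compA gt0 compm0.
Qed.

Lemma epic_cokernel_of_kernel A B D (f : hom A B) (g : hom B D) :
  epic g -> is_kernel g f -> is_cokernel f g.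
Proof.
move=> eg /kernelP [_ gf0 fP]; apply/cokernelP; split=> // T t tf0.
have [E [d /cokernelP [_ gd0 dP]]] := ab_epic_normal eg.
have [d' fd'] := fP _ _ gd0.
by apply: dP; rewrite -fd' compA tf0 comp0m.
Qed.

(** Why [e] is epic: if [w \oc e = 0], then [f] factors through [m \oc k] with [k] the kernel of
    [w]. This monic is the kernel of some [d], which kills [f] and hence [m]; so [m] factors through
    [m \oc k], [k] is split epic, and [w = 0]. *)
Lemma image_factor A B K (f : hom A B) (m : hom K B) :
  is_image f m -> exists2 e : hom A K, epic e & m \oc e = f.
Proof.
move=> [D [c [/cokernelP [_ cf0 cP] /kernelP [mm cm0 mP]]]].
have [e mef] := mP _ _ cf0; exists e => //.
apply/epic0P => T w we0.
have [L [k /kernelP [mk wk0 kP]]] := ab_kernel w.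
have [e' ke'] := kP _ _ we0.
have [F [d /kernelP [_ dmk0 dP]]] := ab_monic_normal (monic_comp mm mk).
have [|d' d'c] := cP _ d; first by rewrite -mef -ke' !compA -(compA d) dmk0 comp0m.
have [|s mks] := dP _ m; first by rewrite -d'c -compA cm0 compm0.
have ks : k \oc s = idm K by apply: mm; rewrite compA mks compm1.
by rewrite -[w]compm1 -ks compA wk0 comp0m.
Qed.

Lemma image_exists A B (f : hom A B) : exists K (m : hom K B), is_image f m.
Proof.
have [D [c fc]] := ab_cokernel f; have [K [m cm]] := ab_kernel c.
by exists K, m, D, c.
Qed.

Lemma image_monic A B K (f : hom A B) (m : hom K B) : is_image f m -> monic m.
Proof. by move=> [D [c [_ /kernel_monic]]]. Qed.

Lemma epic_monic_image A B K (e : hom A K) (m : hom K B) :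
  epic e -> monic m -> is_image (m \oc e) m.
Proof.
move=> ee mm; have [D [c mec]] := ab_cokernel (m \oc e).
exists D, c; split=> //; apply: monic_kernel_of_cokernel => //.
exact/(cokernel_comp_epic _ _ ee).
Qed.

(** [exact] supplies only some image of [f]. Two cokernels of [f] factor through each other, so
    their kernels are the same subobject. *)
Lemma exact_image_kernel A B D K (f : hom A B) (g : hom B D) (m : hom K B) :
  exact f g -> is_image f m -> is_kernel g m.
Proof.
move=> [K' [m' [[E' [c' [/cokernelP [ec' c'f0 c'P]]]]]]].
move=> /kernelP [mm' c'm'0 m'P] /kernelP [_ gm'0 gP].
move=> [E [c [/cokernelP [ec cf0 cP] /kernelP [mm cm0 mP]]]].
have [u uc] := cP _ _ c'f0; have [v vc'] := c'P _ _ cf0.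
apply/kernelP; split=> //.
  have [|r <-] := m'P _ m; first by rewrite -uc -compA cm0 compm0.
  by rewrite compA gm'0 comp0m.
move=> T t /gP [s <-]; apply: mP.
by rewrite -vc' compA -(compA v) c'm'0 compm0 comp0m.
Qed.

Lemma exact_epic_kernel A B D K (e : hom A K) (m : hom K B) (g : hom B D) :
  epic e -> is_kernel g m -> exact (m \oc e) g.
Proof.
move=> ee gm; exists K, m; split=> //.
exact: epic_monic_image ee (kernel_monic gm).
Qed.

Lemma monic_exact_kernel A B D (f : hom A B) (g : hom B D) :
  monic f -> exact f g <-> is_kernel g f.
Proof.
move=> mf; split=> [fg|gf].
  apply: exact_image_kernel fg _.
  by rewrite -[X in is_image X]compm1; apply: epic_monic_image => //; apply: epic_idm.
by rewrite -[f]compm1; apply: exact_epic_kernel => //; apply: epic_idm.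
Qed.

(** * Short exact sequences, pushouts and the horseshoe lemma *)

Lemma short_exact_kernelP A B D (f : hom A B) (g : hom B D) :
  short_exact f g <-> is_kernel g f /\ epic g.
Proof.
split=> [[mf fg eg]|[gf eg]]; first by split=> //; apply/monic_exact_kernel.
have mf := kernel_monic gf.
by split=> //; apply/monic_exact_kernel.
Qed.

Lemma short_exact_cokernelP A B D (f : hom A B) (g : hom B D) :
  short_exact f g <-> monic f /\ is_cokernel f g.
Proof.
split=> [fg|[mf gf]].
  have [mf _ eg] := fg; split=> //.
  by apply: epic_cokernel_of_kernel => //; apply (short_exact_kernelP f g).1.
apply/short_exact_kernelP; split; last exact: cokernel_epic gf.
exact: monic_kernel_of_cokernel.
Qed.

(* Replaces a diagram chase: writing u = m \oc e with e epic and m monic, the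
   hypothesis makes g a multiple of e \oc g, so that e is a split monic. *)
Lemma monic_of_comp_epic A B D (g : hom A B) (u : hom B D) :
  epic g ->
  (forall T (t : hom T A), u \oc (g \oc t) = 0 -> g \oc t = 0) -> monic u.
Proof.
move=> eg ug.
have [I [m um]] := image_exists u; have [e ee meu] := image_factor um.
have [K [k egk]] := ab_kernel (e \oc g).
have := epic_cokernel_of_kernel (epic_comp ee eg) egk.
move=> /cokernelP [_ egk0 egP].
have [|z zeg] := egP _ g.
  by apply: ug; rewrite -meu -compA (compA e) egk0 compm0.
rewrite -meu; apply: monic_comp; first exact: image_monic um.
apply: (@split_monic _ _ _ z); apply: eg.
by rewrite -compA zeg comp1m.
Qed.

(** Third isomorphism theorem for A inside B inside E: [L] is E/A, and [u], [v] are the maps B/A ->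
    E/A -> E/B. *)
Lemma short_exact_quotient A B D E F (f : hom A B) (g : hom B D)
    (j : hom B E) (p : hom E F) :
  short_exact f g -> short_exact j p ->
  exists L (c : hom E L) (u : hom D L) (v : hom L F),
    short_exact (j \oc f) c /\ short_exact u v.
Proof.
move=> /short_exact_cokernelP [mf /cokernelP [eg gf0 gP]] jp.
have [jp1 _] := (short_exact_kernelP j p).1 jp.
have [mj /cokernelP [ep pj0 pP]] := (short_exact_cokernelP j p).1 jp.
have [L [c jfc]] := ab_cokernel (j \oc f).
have mjf := monic_comp mj mf.
have [_ _ jfP] := (kernelP c (j \oc f)).1 (monic_kernel_of_cokernel mjf jfc).
have [ec cjf0 cP] := (cokernelP (j \oc f) c).1 jfc.
have [|u ug] := gP _ (c \oc j); first by rewrite -compA.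
have [|v vc] := cP _ p; first by rewrite compA pj0 comp0m.
exists L, c, u, v; split; first exact/short_exact_cokernelP.
apply/short_exact_cokernelP; split.
  apply: (monic_of_comp_epic eg) => T t; rewrite compA ug -compA => /jfP [s].
  by rewrite -compA => /mj <-; rewrite compA gf0 comp0m.
apply/cokernelP; split.
- by apply: (@epic_of_comp _ _ _ _ v c); rewrite vc.
- by apply: eg; rewrite -compA ug compA vc pj0 comp0m.
- move=> T w wu0; have [|z zp] := pP _ (w \oc c).
    by rewrite -compA -ug compA wu0 comp0m.
  by exists z; apply: ec; rewrite -compA vc.
Qed.

Lemma biproduct_short_exact A B S (iA : hom A S) (iB : hom B S) pA pB :
  is_biproduct iA iB pA pB -> short_exact iA pB.
Proof.
move=> [pAiA pBiB pAiB pBiA iSE]; apply/short_exact_kernelP; split.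
  apply/kernelP; split=> //; first exact: split_monic pAiA.
  move=> T t pBt0; exists (pA \oc t).
  by rewrite -[RHS]comp1m -iSE compDl -!compA pBt0 compm0 addr0.
exact: split_epic pBiB.
Qed.

(** This is the sum of the given sequence with 0 -> M = M -> 0 -> 0. *)
Lemma short_exact_biproductl A B D M S S' (f : hom A B) (g : hom B D)
    (iA : hom A S) (iM : hom M S) pA pM (jB : hom B S') (jM : hom M S') qB qM :
  short_exact f g -> is_biproduct iA iM pA pM -> is_biproduct jB jM qB qM ->
  short_exact (jB \oc f \oc pA + jM \oc pM) (g \oc qB).
Proof.
move=> /short_exact_kernelP [/kernelP [mf gf0 fP] eg].
move=> [pAiA pMiM pAiM pMiA iSE] [qBjB qMjM qBjM qMjB jSE].
have qBh : qB \oc (jB \oc f \oc pA + jM \oc pM) = f \oc pA.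
  by rewrite compDr !compA qBjB qBjM comp0m addr0 comp1m.
have qMh : qM \oc (jB \oc f \oc pA + jM \oc pM) = pM.
  by rewrite compDr !compA qMjB qMjM !comp0m add0r comp1m.
apply/short_exact_kernelP; split; last first.
  exact: epic_comp eg (split_epic qBjB).
apply/kernelP; split.
- apply/monic0P => T t ht0.
  rewrite -[t]comp1m -iSE compDl -!compA.
  have -> : pA \oc t = 0.
    by apply: mf; rewrite compm0 compA -qBh -compA ht0 compm0.
  by rewrite -qMh -compA ht0 !compm0 addr0.
- by rewrite -compA qBh compA gf0 comp0m.
- move=> T t; rewrite -compA => /fP [s fs].
  exists (iA \oc s + iM \oc (qM \oc t)).
  rewrite -[RHS]comp1m -jSE !compDl !compDr -!compA.
  rewrite !(compA pA) !(compA pM) pAiA pAiM pMiA pMiM !comp0m !comp1m.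
  by rewrite !compm0 fs addr0 add0r.
Qed.

(* The pushout of the extension along a splits, and a retraction of it restricts
   to the required map on B. *)
Lemma Ext1_eq0_extend A B D E (f : hom A B) (g : hom B D) (a : hom A E) :
  short_exact f g -> Ext1_eq0 D E -> exists b : hom B E, b \oc f = a.
Proof.
move=> /short_exact_cokernelP [mf /cokernelP [eg gf0 gP]] DE0.
have [S [iB [iE [pB [pE [pBiB pEiE pBiE pEiB iSE]]]]]] := ab_biproduct B E.
(* The cokernel [G] of this antidiagonal map is the pushout of [f] and [a]. *)
pose h := iB \oc f - iE \oc a.
have pBh : pB \oc h = f.
  by rewrite compDr compmN !compA pBiB pBiE comp0m subr0 comp1m.
have pEh : pE \oc h = - a.
  by rewrite compDr compmN !compA pEiE pEiB comp0m sub0r comp1m.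
have mh : monic h.
  by move=> T u v huv; apply: mf; rewrite -pBh -!compA huv.
have [G [q hq]] := ab_cokernel h.
have [_ _ hP] := (kernelP q h).1 (monic_kernel_of_cokernel mh hq).
have [eq qh0 qP] := (cokernelP h q).1 hq.
have qiBE : q \oc iB \oc f = q \oc iE \oc a.
  by apply/eqP; rewrite -subr_eq0 -!compA -compmN -compDr; apply/eqP.
have [|r rq] := qP _ (g \oc pB); first by rewrite -compA pBh.
have ses : short_exact (q \oc iE) r.
  apply/short_exact_cokernelP; split.
    apply/monic0P => T t; rewrite -compA => /hP [s hs].
    have s0 : s = 0.
      by apply: mf; rewrite -{1}pBh -compA hs compA pBiE comp0m compm0.
    by rewrite -[t]comp1m -pEiE -compA -hs s0 !compm0.
  apply/cokernelP; split.
  - apply: (@epic_of_comp _ _ _ _ r q); rewrite rq.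
    exact: epic_comp eg (split_epic pBiB).
  - by rewrite compA rq -compA pBiE compm0.
  - move=> T w wqiE0.
    have [|z zg] := gP _ (w \oc q \oc iB).
      by rewrite -!compA (compA q) qiBE compA wqiE0 comp0m.
    exists z; apply: eq; rewrite -compA rq compA zg.
    rewrite -[RHS]compm1 -iSE compDr !compA -(compA w q iE) wqiE0.
    by rewrite comp0m addr0.
have [e0 [[iD [pE0 [pE0in _ _ _ _]]] [k [kin _]]]] := DE0 (Extension ses).
exists (pE0 \oc k \oc q \oc iB).
by rewrite -!compA (compA q) qiBE (compA k) kin compA pE0in comp1m.
Qed.

(** The vanishing of Ext^1 extends [a] to [b] on [B], and [h] has components [b] and [d \oc g].
    Since [d] is monic, the cokernels form a short exact sequence, as in the snake lemma. *)
Lemma horseshoe A B D E F A' D' S (f : hom A B) (g : hom B D)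
    (a : hom A E) (a' : hom E A') (d : hom D F) (d' : hom F D')
    (iE : hom E S) (iF : hom F S) pE pF :
  short_exact f g -> short_exact a a' -> short_exact d d' ->
  Ext1_eq0 D E -> is_biproduct iE iF pE pF ->
  exists B' (h : hom B S) (c : hom S B') (u : hom A' B') (v : hom B' D'),
    short_exact h c /\ short_exact u v.
Proof.
move=> fg aa' dd' DE0 [pEiE pFiF pEiF pFiE iSE].
have [b bf] := Ext1_eq0_extend a fg DE0.
move: fg aa' dd' => fg /short_exact_cokernelP [ma /cokernelP [ea' a'a0 a'P]].
move=> /short_exact_cokernelP [md /cokernelP [ed' d'd0 d'P]].
have [/kernelP [mf gf0 fP] eg] := (short_exact_kernelP f g).1 fg.
pose h := iE \oc b + iF \oc (d \oc g).
have pEh : pE \oc h = b.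
  by rewrite compDr !compA pEiE pEiF !comp0m addr0 comp1m.
have pFh : pF \oc h = d \oc g.
  by rewrite compDr (compA _ iF) (compA _ iE) pFiE pFiF comp0m add0r comp1m.
(* A map into [B] with vanishing [F]-component under [h] comes from [A], since [d] is monic and [f]
   is the kernel of [g]. *)
have kerg T (t : hom T B) : pF \oc (h \oc t) = 0 -> exists s, f \oc s = t.
  by move=> ht; apply: fP; apply: md; rewrite !compA -pFh -compA ht compm0.
have mh : monic h.
  apply/monic0P => T t ht0; have [|s fst] := kerg _ t; first by rewrite ht0 compm0.
  rewrite -fst; suff -> : s = 0 by rewrite compm0.
  by apply: ma; rewrite -{1}bf -compA fst -pEh -compA ht0 !compm0.
have [B' [c hc]] := ab_cokernel h.
have [_ _ hP] := (kernelP c h).1 (monic_kernel_of_cokernel mh hc).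
have [ec ch0 cP] := (cokernelP h c).1 hc.
have ciF : c \oc iF \oc d \oc g = - (c \oc iE \oc b).
  by apply/eqP; rewrite -addr_eq0 addrC -!compA -compDr; apply/eqP.
have [|u ua'] := a'P _ (c \oc iE).
  by rewrite -bf compA -[LHS]opprK -compNm -ciF -compA gf0 compm0 oppr0.
have [|v vc] := cP _ (d' \oc pF).
  by rewrite -compA pFh compA d'd0 comp0m.
exists B', h, c, u, v; split; first exact/short_exact_cokernelP.
apply/short_exact_cokernelP; split.
  (* If [c] kills [iE \oc t], this map is [h \oc s], and [s] comes from some [r] into [A]; then
     [t = a \oc r], which [a'] kills. *)
  apply: (monic_of_comp_epic ea') => T t; rewrite compA ua' -compA => /hP [s hs].
  have [|r fr] := kerg _ s; first by rewrite hs compA pFiE comp0m.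
  rewrite -[t]comp1m -pEiE -compA -hs (compA pE) pEh -fr (compA b) bf.
  by rewrite (compA a') a'a0 comp0m.
apply/cokernelP; split.
- apply: (@epic_of_comp _ _ _ _ v c); rewrite vc.
  exact: epic_comp ed' (split_epic pFiF).
- by apply: ea'; rewrite -compA ua' compA vc -compA pFiE compm0 comp0m.
- move=> T w wu0.
  (* [w \oc c] vanishes on [E], hence on the image of [d] by [ciF], [g] being epic. Its restriction
     to [F] therefore factors through [d']. *)
  have wciE : w \oc c \oc iE = 0 by rewrite -compA -ua' compA wu0 comp0m.
  have [|z zd'] := d'P _ (w \oc c \oc iF).
    apply: eg; transitivity (w \oc (c \oc iF \oc d \oc g)); first by rewrite !compA.
    by rewrite ciF compmN !compA wciE !comp0m oppr0.
  exists z; apply: ec; rewrite -compA vc compA zd'.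
  by rewrite -[RHS]compm1 -iSE compDr !compA wciE comp0m add0r.
Qed.


(** * Zero objects and finite coproducts *)

Lemma short_exact_zero A B D (f : hom A B) (g : hom B D) :
  short_exact f g -> is_zero_object A -> is_zero_object D -> is_zero_object B.
Proof.
move=> /short_exact_kernelP [/kernelP [_ _ fP] _] [A0 _] [_ D0].
apply/zero_objectP; have [|u <-] := fP _ (idm B); first exact: D0.
by rewrite (A0 _ f) comp0m.
Qed.

Lemma zero_object_exact A B D (f : hom A B) (g : hom B D) :
  is_zero_object A -> is_zero_object B -> exact f g.
Proof.
move=> [_ A0] [B0 B1]; have mf : monic f by apply/monic0P => T t _; apply: A0.
apply/monic_exact_kernel/kernelP => //; split=> // [|T t _].
  by rewrite (B0 _ g) comp0m.
by exists 0; rewrite [RHS]B1 [LHS]B1.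
Qed.

Lemma summand_closed_zero P M : summand_closed P -> P M ->
  @zero_objects C `<=` P.
Proof.
move=> Psmd PM Z Z0; apply: Psmd.
exists M, M, 0, (idm M), 0, (idm M); split=> //.
exact: biproduct_sym (biproduct_zero M Z0).
Qed.

Lemma fin_coproducts_zero P : @zero_objects C `<=` fin_coproducts P.
Proof.
move=> Z [Z0 _]; have no (i : 'I_0) : False by case: i.
exists 0%N, (fun=> Z), (fun i => False_rect _ (no i)); split=> [|i]; last by case: i.
by move=> T g; exists 0; split=> [i|h _]; [case: i|rewrite [RHS]Z0].
Qed.

Lemma fin_coproducts_biproduct P A B S (iA : hom A S) (iB : hom B S) pA pB :
  is_biproduct iA iB pA pB -> P A -> P B -> fin_coproducts P S.
Proof.
move=> [pAiA pBiB pAiB pBiA iSE] PA PB.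
pose F (i : 'I_2) : C := if val i is 0%N then A else B.
pose inj (i : 'I_2) : hom (F i) S :=
  match val i as k return hom (if k is 0%N then A else B) S with
  | 0%N => iA | _ => iB end.
exists 2%N, F, inj; split=> [T g|]; last by case=> -[].
pose gA : hom A T := g (@Ordinal 2 0 isT); pose gB : hom B T := g (@Ordinal 2 1 isT).
exists (gA \oc pA + gB \oc pB); split=> [|h hE].
  case=> -[|[|k]] lti //=.
    rewrite [lti](bool_irrelevance _ isT) /inj /= compDl -!compA.
    by rewrite pAiA pBiA compm1 compm0 addr0.
  rewrite [lti](bool_irrelevance _ isT) /inj /= compDl -!compA.
  by rewrite pAiB pBiB compm1 compm0 add0r.
by rewrite /gA /gB -!hE -!compA -compDr [X in h \oc X]iSE compm1.
Qed.

(** * Cutting and splicing of coresolutions *)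

Section Coseq.

Variable M : C.
Implicit Type s : exact_coseq M.

Section Tail.

Variables (s : exact_coseq M) (K : C) (m : hom K (cr_obj s 1)).
Hypothesis sm : is_image (cr_map s 0) m.

(** The cut at the image [K] of the first map keeps this part; [coseq_head] is the short exact
    sequence cut off. *)
Definition coseq_tail : exact_coseq K := {|
  cr_obj := fun k => cr_obj s k.+1;
  cr_aug := m;
  cr_map := fun k => cr_map s k.+1;
  cr_monic := image_monic sm;
  cr_exact0 := (monic_exact_kernel _ (image_monic sm)).2
    (exact_image_kernel (cr_exactS s 0) sm);
  cr_exactS := fun k => cr_exactS s k.+1 |}.

Lemma coseq_head : exists e : hom (cr_obj s 0) K, short_exact (cr_aug s) e.
Proof.
have [e ee meE] := image_factor sm; exists e.
apply/short_exact_kernelP; split=> //.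
apply/(kernel_monic_comp _ _ (image_monic sm)); rewrite meE.
exact: (monic_exact_kernel _ (@cr_monic _ _ s)).1 (cr_exact0 s).
Qed.

End Tail.

Section Cons.

Variables (Q0 K : C) (f : hom M Q0) (g : hom Q0 K).
Hypothesis fg : short_exact f g.
Variable s : exact_coseq K.

Definition cons_obj k := if k is k'.+1 then cr_obj s k' else Q0.

(** The splice at [K]: the map in degree 0 is an epic onto [K] followed by a monic, so its image is
    [K]. *)
Definition cons_map k : hom (cons_obj k) (cons_obj k.+1) :=
  match k with 0%N => cr_aug s \oc g | k'.+1 => cr_map s k' end.

Lemma cons_image0 : is_image (cons_map 0) (cr_aug s).
Proof.
by apply: epic_monic_image; [have [] := fg|apply: cr_monic].
Qed.

Lemma cons_exact0 : exact f (cons_map 0).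
Proof.
have [mf _ _] := fg; apply/(monic_exact_kernel _ mf).
apply/(kernel_monic_comp _ _ (@cr_monic _ _ s)).
exact: ((short_exact_kernelP f g).1 fg).1.
Qed.

Lemma cons_exactS k : exact (cons_map k) (cons_map k.+1).
Proof.
case: k => [|k]; last exact: cr_exactS.
apply: exact_epic_kernel; first by have [] := fg.
exact: (monic_exact_kernel _ (@cr_monic _ _ s)).1 (cr_exact0 s).
Qed.

Definition coseq_cons : exact_coseq M := {|
  cr_obj := cons_obj;
  cr_aug := f : hom M (cons_obj 0);
  cr_map := cons_map;
  cr_monic := let: And3 mf _ _ := fg in mf;
  cr_exact0 := cons_exact0;
  cr_exactS := cons_exactS |}.

End Cons.

End Coseq.

(** * The operator F, its coinduction principle and its finite iterates *)

Definition coresolution_step P Q V : set C :=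
  [set M | P M /\ exists (Q0 K : C) (f : hom M Q0) (g : hom Q0 K),
    [/\ short_exact f g, Q Q0 & V K]].

Lemma coresolution_step_mono P Q V V' :
  V `<=` V' -> coresolution_step P Q V `<=` coresolution_step P Q V'.
Proof.
move=> VV' M [PM [Q0 [K [f [g [fg QQ0 VK]]]]]]; split=> //.
by exists Q0, K, f, g; split=> //; apply: VV'.
Qed.

(** [Q0] is an extension of [K] by [M], both of which lie in [P]. *)
Lemma coresolution_stepI P Q V : extension_closed P -> V `<=` P ->
  coresolution_step P Q V `<=` coresolution_step P (P `&` Q) V.
Proof.
move=> Pext VP M [PM [Q0 [K [f [g [fg QQ0 VK]]]]]]; split=> //.
exists Q0, K, f, g; split=> //; split=> //.
by apply: Pext fg PM _; apply: VP.
Qed.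

Lemma rel_cores_inf_step P Q :
  @zero_objects C `<=` P -> @zero_objects C `<=` Q ->
  rel_cores_inf P Q `<=` coresolution_step P Q (rel_cores_inf P Q).
Proof.
move=> P0 Q0 M [PM [s [sQ sP]]]; split=> //.
have [K [m [sm PK]]] := sP 0%N; have [e se] := coseq_head sm.
exists (cr_obj s 0), K, (cr_aug s), e; split=> //.
  by case: (sQ 0%N) => // /Q0.
split; first by case: PK => // /P0.
by exists (coseq_tail sm); split=> k; [apply: sQ|apply: sP].
Qed.

(** Choosing a short exact sequence for every object of [V] and splicing them without end yields a
    coresolution. *)
Lemma rel_cores_inf_coind P Q V :
  V `<=` coresolution_step P Q V -> V `<=` rel_cores_inf P Q.
Proof.
move=> VS M VM; split; first by have [] := VS _ VM.
(* The states are objects bundled with a proof of membership in [V], so that one chosen step can be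
   iterated. *)
have next (x : {K | V K}) :
    exists d : {Q0 : C & {y : {K | V K} &
      (hom (sval x) Q0 * hom Q0 (sval y))%type}},
    Q (projT1 d) /\ short_exact (projT2 (projT2 d)).1 (projT2 (projT2 d)).2.
  have [_ [Q0 [K [f [g [fg QQ0 VK]]]]]] := VS _ (svalP x).
  by exists (existT _ Q0 (existT _ (exist _ K VK) (f, g))).
pose d x := sval (cid (next x)).
have dP x : Q (projT1 (d x)) /\
    short_exact (projT2 (projT2 (d x))).1 (projT2 (projT2 (d x))).2.
  exact: svalP (cid (next x)).
pose x k := iter k (fun x => projT1 (projT2 (d x))) (exist _ M VM).
pose i k := (projT2 (projT2 (d (x k)))).1.
pose p k : hom (projT1 (d (x k))) (sval (x k.+1)) := (projT2 (projT2 (d (x k)))).2.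
have ip k : is_kernel (p k) (i k) /\ epic (p k).
  exact: (short_exact_kernelP (i k) (p k)).1 (dP (x k)).2.
have ker_i k : is_kernel (i k.+1 \oc p k) (i k).
  by apply/(kernel_monic_comp _ _ (kernel_monic (ip k.+1).1)); exact: (ip k).1.
have mi k : monic (i k) := kernel_monic (ip k).1.
exists {| cr_obj := fun k => projT1 (d (x k));
          cr_aug := i 0%N : hom M _;
          cr_map := fun k => i k.+1 \oc p k;
          cr_monic := mi 0%N;
          cr_exact0 := (monic_exact_kernel _ (mi 0%N)).2 (ker_i 0%N);
          cr_exactS := fun k => exact_epic_kernel (ip k).2 (ker_i k.+1) |}.
split=> k /=; first by left; exact: (dP (x k)).1.
exists (sval (x k.+1)), (i k.+1); split.
  exact: epic_monic_image (ip k).2 (mi k.+1).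
by left; have [] := VS _ (svalP (x k.+1)).
Qed.

(** Stages count short exact sequences down to a zero object. A coresolution of length [n], whose
    last sequence ends in Q_n -> 0, uses [n.+1] of them. *)
Definition fin_step P Q n : set C :=
  iter n (coresolution_step P Q) (P `&` @zero_objects C).

Lemma fin_step_sub P Q n : fin_step P Q n `<=` P.
Proof. by case: n => [|n] M []. Qed.

Lemma fin_step_cores P Q n : @zero_objects C `<=` Q ->
  fin_step P Q n `<=` rel_cores_fin P Q.
Proof.
move=> Q0; elim: n => [|n IHn] M.
  move=> [PM M0]; split=> //; have ex (f g : hom M M) : exact f g.
    exact: zero_object_exact.
  (* A zero object is coresolved by its own identity maps, the constant sequence being exact. *)
  exists 0%N, {| cr_obj := fun=> M; cr_aug := idm M; cr_map := fun=> idm M;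
    cr_monic := @monic_idm _ M; cr_exact0 := ex _ _; cr_exactS := fun=> ex _ _ |}.
  by split=> //; split=> //; apply: Q0.
move=> [PM [Q1 [K [f [g [fg QQ1 /IHn [PK [k [s [s0 sk sQ sP]]]]]]]]]].
split=> //; exists k.+1, (coseq_cons fg s); split=> //=.
- by case=> // j; apply: s0.
- by case=> // j; apply: sQ.
- case=> [_|j]; last exact: sP.
  by exists K, (cr_aug s); split=> //; exact: cons_image0 fg s.
Qed.

Lemma cores_fin_step P Q n M (s : exact_coseq M) :
  summand_closed P -> @zero_objects C `<=` P ->
  P M -> is_coresolution_of_length P Q n s -> fin_step P Q n.+1 M.
Proof.
move=> Psmd P0; elim: n M s => [|n IHn] M s PM [s0 sn sQ sP].
  (* In length 0 the image [K] embeds in Q_1 = 0. *)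
  have [K [m sm]] := image_exists (cr_map s 0); have [e se] := coseq_head sm.
  have K0 : is_zero_object K := zero_object_monic (image_monic sm) (s0 1%N isT).
  split=> //; exists (cr_obj s 0), K, (cr_aug s), e; split=> //; first exact: sn.2.
  by split=> //; apply: P0.
have [K [m [sm PK]]] : image_in P (cr_map s 0).
  (* In length 1 the definition imposes no condition on images. As Q_2 = 0, [m] is an isomorphism
     onto Q_1, an object of [P], and closure under summands carries membership over to [K]. *)
  case: n {IHn} => [|n] in s0 sn sQ sP *; last exact: sP.
  have [K [m sm]] := image_exists (cr_map s 0); exists K, m; split=> //.
  have mm := image_monic sm.
  have [_ _ mP] := (kernelP _ _).1 (exact_image_kernel (cr_exactS s 0) sm).
  have [|u mu] := mP _ (idm _); first exact: (s0 2%N isT).2.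
  have um : u \oc m = idm K by apply: mm; rewrite compA mu comp1m compm1.
  have [Z Z0] := ab_zero C.
  apply: Psmd; exists Z, (cr_obj s 1), m, 0, u, 0; split; last exact: sn.1.
  by split; rewrite ?comp0m ?compm0 ?addr0 // [RHS](Z0.1).
have [e se] := coseq_head sm; split=> //.
exists (cr_obj s 0), K, (cr_aug s), e; split=> //; first exact: sQ.
apply: IHn (coseq_tail sm) PK _; split=> //= k.
- exact: (s0 k.+1).
- exact: (sQ k.+1).
- exact: (sP k.+1).
Qed.

Lemma rel_cores_finE P Q :
  summand_closed P -> @zero_objects C `<=` P -> @zero_objects C `<=` Q ->
  rel_cores_fin P Q = \bigcup_n fin_step P Q n.
Proof.
move=> Psmd P0 Q0; rewrite eqEsubset; split=> M.
  by move=> [PM [n [s sn]]]; exists n.+1 => //; apply: cores_fin_step sn.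
by move=> [n _]; apply: fin_step_cores.
Qed.

(** By monotonicity of the operator it suffices to compare the first two stages, where a zero object
    [M] has the sequence M = M = M. *)
Lemma fin_step_leq P Q n k : @zero_objects C `<=` Q -> (n <= k)%N ->
  fin_step P Q n `<=` fin_step P Q k.
Proof.
move=> Q0 /subnK <-; elim: (k - n)%N => // j IHj.
apply: (subset_trans IHj) => {IHj} M; rewrite addSn.
elim: (j + n)%N M => [|i IHi] M; last exact: coresolution_step_mono.
move=> [PM M0]; split=> //; exists M, M, (idm M), (idm M); split=> //; last exact: Q0.
split; [exact: monic_idm|exact: zero_object_exact|exact: epic_idm].
Qed.

(** * Closure properties of the classes of relative coresolutions *)

Section RelativeCoresolutions.

Variables X Y : set C.
Hypothesis Xsmd : summand_closed X.
Hypothesis Xext : extension_closed X.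
Hypothesis Yzero : @zero_objects C `<=` Y.
Hypothesis Ybiproduct : forall A B S (iA : hom A S) (iB : hom B S) pA pB,
  is_biproduct iA iB pA pB -> Y A -> Y B -> Y S.
Hypothesis Xzero : @zero_objects C `<=` X.
Hypothesis XYExt : Ext1_class_eq0 X (X `&` Y).

Definition extensions V : set C :=
  [set B | exists (A D : C) (f : hom A B) (g : hom B D),
    [/\ short_exact f g, V A & V D]].

(** [E] is an extension of [A'] by [A], so it lies in [X] as well as in [Y]; hence Ext^1(D, E) = 0
    and the horseshoe lemma applies. *)
Lemma coresolution_step_extension V : V `<=` X ->
  extensions (coresolution_step X Y V) `<=` coresolution_step X Y (extensions V).
Proof.
move=> VX B [A [D [f [g [fg AV DV]]]]].
have [XA [E [A' [a [a' [aa' YE VA']]]]]] := AV.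
have [XD [F [D' [d [d' [dd' YF VD']]]]]] := DV.
split; first exact: Xext fg XA XD.
have XE : X E by apply: Xext aa' XA _; apply: VX.
have [S [iE [iF [pE [pF bS]]]]] := ab_biproduct E F.
have [B' [h [c [u [v [hc uv]]]]]] :=
  horseshoe fg aa' dd' (XYExt XD (conj XE YE)) bS.
exists S, B', h, c; split=> //; first exact: Ybiproduct bS YE YF.
by exists A', D', u, v.
Qed.

Let W := rel_cores_inf X Y.

Let W_step : W `<=` coresolution_step X Y W.
Proof. exact: rel_cores_inf_step. Qed.

Let WX : W `<=` X.
Proof. by move=> M []. Qed.

Let XYzero : @zero_objects C `<=` X `&` Y.
Proof. by move=> Z Z0; split; [apply: Xzero|apply: Yzero]. Qed.

(** Each class is contained in its image under the operator of the other, so coinduction gives both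
    inclusions. *)
Lemma rel_cores_infI : W = rel_cores_inf X (X `&` Y).
Proof.
rewrite eqEsubset; split.
  apply: rel_cores_inf_coind; apply: (subset_trans W_step).
  exact: coresolution_stepI.
apply: rel_cores_inf_coind => M WM.
have [XM [Q0 [K [f [g [fg [_ YQ0] WK]]]]]] := rel_cores_inf_step Xzero XYzero WM.
by split=> //; exists Q0, K, f, g.
Qed.

Lemma rel_cores_inf_extension : extension_closed W.
Proof.
move=> A B D f g fg WA WD.
(* Coinduction is applied to the whole class of extensions, because the horseshoe lemma yields a
   cokernel that is again such an extension. *)
suff: extensions W `<=` W by apply; exists A, D, f, g.
apply: rel_cores_inf_coind => {A B D f g fg WA WD} B [A [D [f [g [fg WA WD]]]]].
apply: coresolution_step_extension => //.
by exists A, D, f, g; split=> //; apply: W_step.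
Qed.

Lemma rel_cores_inf_summand : summand_closed W.
Proof.
apply: rel_cores_inf_coind => M [N [S [iM [iN [pM [pN [bS WS]]]]]]].
split.
  by apply: Xsmd; exists N, S, iM, iN, pM, pN; split=> //; apply: WX.
have [_ [Q0 [K [f [g [fg YQ0 WK]]]]]] := W_step WS.
have [L [c [u [v [fc uv]]]]] := short_exact_quotient (biproduct_short_exact bS) fg.
exists Q0, L, (f \oc iM), c; split=> //.
(* [L] is a summand of [T], which is an extension of [K] by [S]. *)
have [T [jL [jM [qL [qM bT]]]]] := ab_biproduct L M.
exists M, T, jL, jM, qL, qM; split=> //.
exact: rel_cores_inf_extension
  (short_exact_biproductl uv (biproduct_sym bS) bT) WS WK.
Qed.

Lemma rel_cores_inf_epikernel : epikernel_closed X -> epikernel_closed W.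
Proof.
move=> Xepi A B D f g fg WB WD.
(* Adjoining [A] alone suffices for the coinduction, since the cokernel of A -> Q_0 already lies in
   [W]. *)
pose V := W `|` [set A].
suff: V `<=` W by apply; right.
apply: rel_cores_inf_coind => M [WM|->].
  by apply: coresolution_step_mono (W_step WM) => K; left.
split; first by apply: Xepi fg _ _; apply: WX.
have [_ [Q0 [K [b [b' [bb' YQ0 WK]]]]]] := W_step WB.
have [L [c [u [v [fc uv]]]]] := short_exact_quotient fg bb'.
exists Q0, L, (b \oc f), c; split=> //; left.
exact: rel_cores_inf_extension uv WD WK.
Qed.

Lemma rel_cores_finI : rel_cores_fin X Y = rel_cores_fin X (X `&` Y).
Proof.
rewrite !rel_cores_finE //; congr bigcup; apply: funext => n.
(* The two towers agree stage by stage: every stage lies in [X], which forces Q_0 into [X]. *)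
rewrite eqEsubset; split; elim: n => // n IHn.
  apply: (subset_trans (coresolution_stepI Xext (@fin_step_sub _ _ _))).
  exact: coresolution_step_mono.
move=> M /(coresolution_step_mono IHn) [XM [Q0 [K [f [g [fg [_ YQ0] WK]]]]]].
by split=> //; exists Q0, K, f, g.
Qed.

Lemma fin_step_extension n : extensions (fin_step X Y n) `<=` fin_step X Y n.
Proof.
elim: n => [|n IHn] B; last first.
  move=> /(coresolution_step_extension (@fin_step_sub _ _ _)).
  exact: coresolution_step_mono.
move=> [A [D [f [g [fg [XA A0] [XD D0]]]]]].
by split; [apply: Xext fg XA XD|apply: short_exact_zero fg A0 D0].
Qed.

Lemma rel_cores_fin_extension : extension_closed (rel_cores_fin X Y).
Proof.
rewrite rel_cores_finE // => A B D f g fg [n _ An] [k _ Dk].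
(* Stages increase, so both ends lie in a common one. *)
exists (maxn n k) => //; apply: fin_step_extension; exists A, D, f, g; split=> //.
  exact: fin_step_leq (leq_maxl n k) _ An.
exact: fin_step_leq (leq_maxr n k) _ Dk.
Qed.

End RelativeCoresolutions.

End Abelian.

Theorem theorem4p19 (C : abelianCategory) (X Y : set C)
    (hY : Y = fin_coproducts Y)
    (hXsmd : X = smd X)
    (hXext : extension_closed X)
    (hExt : Ext1_class_eq0 X (X `&` Y)) :
  ((rel_cores_inf X Y = rel_cores_inf X (X `&` Y) /\
    extension_closed (rel_cores_inf X Y) /\
    summand_closed (rel_cores_inf X Y)) /\
   (rel_cores_fin X Y = rel_cores_fin X (X `&` Y) /\
    extension_closed (rel_cores_fin X Y))) /\
  (left_thick X -> left_thick (rel_cores_inf X Y)).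
Proof.
have Xsmd : summand_closed X by rewrite /summand_closed -hXsmd.
have Yzero : @zero_objects C `<=` Y.
  by rewrite hY; apply: fin_coproducts_zero.
have Ybi A B S (iA : hom A S) (iB : hom B S) pA pB :
    is_biproduct iA iB pA pB -> Y A -> Y B -> Y S.
  by rewrite [X in _ -> _ -> _ -> X S]hY; apply: fin_coproducts_biproduct.
(* Zero objects lie in [X] as summands of any of its objects, so an empty [X] is treated apart; all
   the classes in question are then empty. *)
have [[M XM]|X0] := pselect (exists M, X M); last first.
  have inf0 Q : rel_cores_inf X Q = set0.
    by rewrite -subset0 => M [XM _]; apply: X0; exists M.
  have fin0 Q : rel_cores_fin X Q = set0.
    by rewrite -subset0 => M [XM _]; apply: X0; exists M.
  have smd0 : summand_closed (@set0 C) by move=> M [? [? [? [? [? [? [_ []]]]]]]].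
  by rewrite !inf0 !fin0; do !split.
have Xzero := summand_closed_zero Xsmd XM.
have ext_inf := rel_cores_inf_extension hXext Yzero Ybi Xzero hExt.
have smd_inf := rel_cores_inf_summand Xsmd hXext Yzero Ybi Xzero hExt.
have infI := rel_cores_infI hXext Yzero Xzero.
have finI := rel_cores_finI Xsmd hXext Yzero Xzero.
have ext_fin := rel_cores_fin_extension Xsmd hXext Yzero Ybi Xzero hExt.
split=> // -[_ _ Xepi]; split=> //.
exact: rel_cores_inf_epikernel Xepi.
Qed.
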